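(* Let $\le_{\operatorname{int}}$ be an admissible total order on $\operatorname{int}(\mathbb{R})$ (i.e. a total order refining the Kulisch–Miranker partial order $\le_{KM}$), and let $\{\alpha_n\}_{n\in\mathbb{N}_0}$ be an upper dense sequence in $(0,1]$. Define $\Phi_{adm}:\operatorname{FN}(\mathbb{R})\to\operatorname{seq}(\operatorname{int}(\mathbb{R}))$ by $$\Phi_{adm}(A)=\{A_{\alpha_0},A_{\alpha_1},A_{\alpha_2},\dots\}\quad\text{for all }A\in\operatorname{FN}(\mathbb{R}),$$ where $A_{\alpha_n}$ is the $\alpha_n$-cut of $A$. Then the $\Phi_{adm}$-sequential binary relation $\le_{\Phi_{adm}}$ is an admissible order on $\operatorname{FN}(\mathbb{R})$.
   Context: $\operatorname{int}(\mathbb{R})=\{[a,b]:a,b\in\mathbb{R},\ a\le b\}$, and $[a,b]\le_{KM}[c,d]$ iff $a\le c$ and $b\le d$. A relation $\le_{\operatorname{int}}$ refines $\le_{KM}$ if $U\le_{KM}V$ implies $U\le_{\operatorname{int}}V$. A fuzzy set on $\mathbb{R}$ is a map $A:\mathbb{R}\to[0,1]$; for $\alpha\in(0,1]$ its $\alpha$-cut is $A_\alpha=\{x:A(x)\ge\alpha\}$, and $A_0$ is the closure of the support $\bigcup_{\alpha\in(0,1]}A_\alpha$. $A$ is a fuzzy number if $A_1\neq\emptyset$, $A_0$ is bounded, and $A_\alpha=[\underline{A}_\alpha,\overline{A}_\alpha]$ is a closed interval for each $\alpha\in(0,1]$ (we use the same endpoint notation for $\alpha=0$); $\operatorname{FN}(\mathbb{R})$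 is the set of fuzzy numbers. The Klir–Yuan partial order is: $A\le_{KY}B$ iff $\underline{A}_\alpha\le\underline{B}_\alpha$ and $\overline{A}_\alpha\le\overline{B}_\alpha$ for all $\alpha\in[0,1]$. An admissible order on $\operatorname{FN}(\mathbb{R})$ is a total order $\le_{adm}$ such that $A\le_{KY}B$ implies $A\le_{adm}B$. A sequence $\{\alpha_n\}\subset(0,1]$ is upper dense if for each $\beta\in(0,1]$ and each $\varepsilon>0$ there is $m$ with $\alpha_m\in[\beta,\beta+\varepsilon)$. For a totally ordered set $(K,\le)$, $\operatorname{seq}(K)=K^{\mathbb{N}_0}$ with $\mathbb{N}_0=\{0,1,2,\dots\}$, and $\mathfrak a\sqsubseteq\mathfrak b$ means that either $\mathfrak a=\mathfrak b$, or there is $n_0\in\mathbb{N}_0$ with $a_n=b_n$ for all $n<n_0$ and $a_{n_0}<b_{n_0}$. Here $K=\operatorname{int}(\mathbb{R})$ with $\le_{\operatorname{int}}$. For $\Phi:X\to\operatorname{seq}(K)$, $x\le_\Phi y$ iff $\Phi(x)\sqsubseteq\Phi(y)$. *)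

(* Defs.v *)
From mathcomp Require Import all_boot all_order all_algebra.
From mathcomp Require Import all_classical all_reals all_analysis.
From Stdlib Require Import Relation_Definitions.
Set Implicit Arguments.
Unset Strict Implicit.
Unset Printing Implicit Defensive.
Import Order.TTheory GRing.Theory Num.Theory.
Import numFieldNormedType.Exports.
Local Open Scope classical_set_scope.
Local Open Scope ring_scope.

(* [Relation_Definitions.order]: reflexive, transitive and antisymmetric. *)
Definition total_order (T : Type) (le : T -> T -> Prop) : Prop :=
  Relation_Definitions.order T le /\ (forall x y, le x y \/ le y x).

Definition refines (T : Type) (le1 le2 : T -> T -> Prop) : Prop :=
  forall x y, le2 x y -> le1 x y.

Definition strict (T : Type) (le : T -> T -> Prop) (x y : T) : Prop :=
  le x y /\ x <> y.

Definition seq_le (K : Type) (le : K -> K -> Prop) (a b : nat -> K) : Prop :=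
  a = b \/
  exists n0 : nat,
    (forall n, (n < n0)%N -> a n = b n) /\ strict le (a n0) (b n0).

Definition sequential_rel (X K : Type) (le : K -> K -> Prop)
    (Phi : X -> nat -> K) (x y : X) : Prop :=
  seq_le le (Phi x) (Phi y).

Definition is_closed_interval (R : realType) (U : set R) : Prop :=
  exists a b : R, a <= b /\ U = [set` `[a, b]].

(* int(R): the nonempty compact intervals, as subsets of R *)
Record interval_num (R : realType) := IntervalNum {
  interval_set :> set R;
  interval_setP : is_closed_interval interval_set }.

(* The endpoints of [a, b] with a <= b are its infimum and its supremum. *)
Definition le_KM (R : realType) (U V : interval_num R) : Prop :=
  inf U <= inf V /\ sup U <= sup V.

Definition admissible_interval_order (R : realType)
    (le : interval_num R -> interval_num R -> Prop) : Prop :=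
  total_order le /\ refines le (@le_KM R).

Definition level_set (R : realType) (A : R -> R) (alpha : R) : set R :=
  [set x | alpha <= A x].

Definition fuzzy_support (R : realType) (A : R -> R) : set R :=
  \bigcup_(alpha in [set` `]0, 1]]) level_set A alpha.

Definition cut (R : realType) (A : R -> R) (alpha : R) : set R :=
  if alpha == 0 then closure (fuzzy_support A) else level_set A alpha.

Record fuzzy_number (R : realType) := FuzzyNumber {
  membership :> R -> R;
  membership01 : forall x, 0 <= membership x <= 1;
  cut1_neq0 : cut membership 1 !=set0;
  cut0_bounded : bounded_set (cut membership 0);
  cut_closed_interval : forall alpha : R, 0 < alpha <= 1 ->
    is_closed_interval (cut membership alpha) }.

(* For a fuzzy number A, every cut (also for alpha = 0) is a nonempty compact
   interval, so these are its endpoints for all alpha in [0, 1]. *)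
Definition lower_end (R : realType) (A : fuzzy_number R) (alpha : R) : R :=
  inf (cut A alpha).

Definition upper_end (R : realType) (A : fuzzy_number R) (alpha : R) : R :=
  sup (cut A alpha).

Definition le_KY (R : realType) (A B : fuzzy_number R) : Prop :=
  forall alpha : R, 0 <= alpha <= 1 ->
    lower_end A alpha <= lower_end B alpha /\
    upper_end A alpha <= upper_end B alpha.

Definition admissible_fuzzy_order (R : realType)
    (le : fuzzy_number R -> fuzzy_number R -> Prop) : Prop :=
  total_order le /\ refines le (@le_KY R).

Definition upper_dense (R : realType) (alpha : nat -> R) : Prop :=
  forall beta eps : R, 0 < beta <= 1 -> 0 < eps ->
    exists m : nat, beta <= alpha m < beta + eps.

Definition Phi_adm (R : realType) (alpha : nat -> R)
    (alpha01 : forall n, 0 < alpha n <= 1) (A : fuzzy_number R) :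
    nat -> interval_num R :=
  fun n => IntervalNum (cut_closed_interval A (alpha01 n)).

(* Main.v *)
(** The lexicographic order on sequences over a total order is total, so it
    pulls back to a total order along any injection. The map [Phi_adm] is
    injective: if [A x < B x], upper density yields some [m] with
    [A x < alpha m < B x], and [x] then separates the [alpha m]-cuts of [A] and [B].
    Finally [A <=_KY B] gives [<=_KM] at every level, hence [<=_int] at the
    first level where the cuts differ. *)

Require Import Defs.
From mathcomp Require Import all_boot all_order all_algebra.
From mathcomp Require Import all_classical all_reals all_analysis.
From mathcomp Require Import lra.
Import Order.TTheory GRing.Theory Num.Theory.
Local Open Scope ring_scope.

Lemma first_difference (K : Type) (a b : nat -> K) : a <> b ->
  exists n0, (forall n, (n < n0)%N -> a n = b n) /\ a n0 <> b n0.
Proof.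
move=> ab; have neq_ex : exists n, `[< a n <> b n >].
  apply: contrapT => nex; apply: ab; apply/funext => n.
  by apply: contrapT => abn; apply: nex; exists n; apply/asboolP.
have [n0 /asboolP abn0 minn0] := ex_minnP neq_ex.
exists n0; split=> // k kn0; apply: contrapT => abk.
by have := minn0 k (introT (asboolP _) abk); rewrite leqNgt kn0.
Qed.

Lemma seq_le_pointwise (K : Type) (le : K -> K -> Prop) (a b : nat -> K) :
  (forall n, le (a n) (b n)) -> seq_le le a b.
Proof.
move=> leab; have [->|/first_difference[n [eqn neqn]]] := pselect (a = b).
  by left.
by right; exists n.
Qed.

(** Two sequences are compared at their first difference. For transitivity and antisymmetry, the
    smaller of the two first-difference indices decides; when they coincide, antisymmetry of [le]
    does. *)
Lemma seq_le_total_order (K : Type) (le : K -> K -> Prop) :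
  total_order le -> total_order (seq_le le).
Proof.
move=> [[_ le_trans le_anti] le_total]; split; last first.
  move=> a b; have [->|/first_difference[n [eqn neqn]]] := pselect (a = b).
    by left; left.
  case: (le_total (a n) (b n)) => ?; [left|right]; right; exists n; split=> //.
    by move=> k /eqn.
  by split=> // /esym.
split; first by move=> a; left.
- move=> a b c [->//|[n [eqn [len neqn]]]] [<-|[m [eqm [lem neqm]]]].
    by right; exists n.
  right; case: (ltngtP n m) => [nm|mn|nm].
  + exists n; split; last by rewrite -(eqm n nm).
    by move=> k kn; rewrite eqn// eqm// (ltn_trans kn).
  + exists m; split; last by rewrite (eqn m mn).
    by move=> k km; rewrite eqn ?(ltn_trans km)// eqm.
  + rewrite -{}nm in eqm lem neqm; exists n; split.
      by move=> k kn; rewrite eqn// eqm.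
    split; first exact: le_trans lem.
    (* If [a n = c n], then [b n] lies between [a n] and itself, forcing [a n = b n]. *)
    by move=> ac; apply: neqn; apply: le_anti; rewrite // ac.
- move=> a b [//|[n [eqn [len neqn]]]] [//|[m [eqm [lem neqm]]]].
  exfalso; case: (ltngtP n m) => [nm|mn|nm].
  + by apply: neqn; rewrite eqm.
  + by apply: neqm; rewrite eqn.
  + by apply: neqn; apply: le_anti; rewrite // nm.
Qed.

(** Injectivity of [Phi] is what turns antisymmetry on sequences into antisymmetry on [X]. *)
Lemma sequential_rel_total_order (X K : Type) (le : K -> K -> Prop)
    (Phi : X -> nat -> K) :
  total_order le -> injective Phi -> total_order (sequential_rel le Phi).
Proof.
move=> /seq_le_total_order[[le_refl le_trans le_anti] le_total] Phi_inj.
split; last by move=> x y; exact: le_total.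
split; first by move=> x; exact: le_refl.
  by move=> x y z; exact: le_trans.
by move=> x y xy yx; apply: Phi_inj; exact: le_anti.
Qed.

(** The other fields of the record are proofs, identified by proof irrelevance. *)
Lemma fuzzy_number_inj (R : realType) (A B : fuzzy_number R) :
  membership A =1 membership B -> A = B.
Proof.
case: A B => [a a1 a2 a3 a4] [b b1 b2 b3 b4] /= /funext ab.
by subst b; congr FuzzyNumber; exact: Prop_irrelevance.
Qed.

Lemma in_cut (R : realType) (A : R -> R) (alpha x : R) : 0 < alpha ->
  Defs.cut A alpha x = (alpha <= A x).
Proof. by move=> alpha0; rewrite /Defs.cut gt_eqF. Qed.

(** One half of injectivity; used in both directions, it gives equality of the membership
    functions. *)
Lemma le_membership_of_cut (R : realType) (alpha : nat -> R)
    (A B : fuzzy_number R) :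
  (forall n, 0 < alpha n <= 1) -> upper_dense alpha ->
  (forall n x, Defs.cut B (alpha n) x -> Defs.cut A (alpha n) x) ->
  forall x, B x <= A x.
Proof.
move=> alpha01 alpha_dense cutBA x; rewrite leNgt; apply/negP => AB.
have /andP[A0 A1] := membership01 A x; have /andP[B0 B1] := membership01 B x.
(* Starting at the midpoint with half the gap as width, the window ends exactly at [B x], so
   [alpha m] lies strictly between [A x] and [B x]. *)
have [||m /andP[lem ltm]] :=
  alpha_dense ((A x + B x) / 2) ((B x - A x) / 2); [by lra|by lra|].
have /andP[m0 _] := alpha01 m.
have := cutBA m x; rewrite !in_cut// => /(_ ltac:(lra)).
lra.
Qed.

Lemma Phi_adm_inj (R : realType) (alpha : nat -> R)
    (alpha01 : forall n, 0 < alpha n <= 1) :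
  upper_dense alpha -> injective (Phi_adm alpha01).
Proof.
move=> alpha_dense A B AB.
have cutAB n : Defs.cut A (alpha n) = Defs.cut B (alpha n).
  by have /(congr1 (fun s => interval_set (s n))) := AB.
apply: fuzzy_number_inj => x; apply/eqP; rewrite eq_le.
by apply/andP; split; apply: (le_membership_of_cut _ alpha) => // n y;
  rewrite cutAB.
Qed.

Theorem theorem5p5 (R : realType)
    (le_int : interval_num R -> interval_num R -> Prop)
    (le_int_adm : admissible_interval_order le_int)
    (alpha : nat -> R)
    (alpha01 : forall n : nat, 0 < alpha n <= 1)
    (alpha_dense : upper_dense alpha) :
  admissible_fuzzy_order (sequential_rel le_int (Phi_adm alpha01)).
Proof.
have [le_total le_refines] := le_int_adm.
split; first by apply: sequential_rel_total_order => //; exact: Phi_adm_inj.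
(* At level [alpha n], the two endpoint inequalities of [le_KY] are by definition [le_KM] between
   the cuts. *)
move=> A B AB; apply: seq_le_pointwise => n; apply: le_refines.
by apply: AB; have /andP[/ltW-> ->] := alpha01 n.
Qed.
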